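(* For every $k\ge 1$, the composition of $\widetilde{NH}$-bimodule homomorphisms $d(u_{k+1})\circ d(u_k):\mathcal{F}^{(k-1)}\to\mathcal{F}^{(k+1)}$ is zero. Consequently $$\exp(-\mathcal{F})=\Big(\bigoplus_{k\ge 0}\mathcal{F}^{(k)}[-k],\ d=\bigoplus_{k\ge 1}d(u_k)\Big)$$ is a cochain complex of $\widetilde{NH}$-bimodules.
   Context: $\widetilde{NH}$ is the associative (non-unital, idempotented) $\mathbb{Z}$-algebra with generators $1_n$ ($n\ge 0$), $\partial_{i,n}$ ($1\le i\le n-1$), $x_{i,n}$ ($1\le i\le n$), $v_{i,n}$ ($1\le i\le n$), and relations (for all admissible indices): (1) $1_n1_m=\delta_{n,m}1_n$, $1_n\partial_{i,n}=\partial_{i,n}1_n=\partial_{i,n}$, $1_nx_{i,n}=x_{i,n}1_n=x_{i,n}$, $1_{n-1}v_{i,n}=v_{i,n}1_n=v_{i,n}$; (2) $x_{i,n}x_{j,n}=x_{j,n}x_{i,n}$; $x_{i,n}\partial_{j,n}=\partial_{j,n}x_{i,n}$ if $i\ne j,j+1$; $\partial_{i,n}\partial_{j,n}=\partial_{j,n}\partial_{i,n}$ if $|i-j|>1$; $\partial_{i,n}^2=0$; $\partial_{i,n}\partial_{i+1,n}\partial_{i,n}=\partial_{i+1,n}\partial_{i,n}\partial_{i+1,n}$; $x_{i,n}\partial_{i,n}-\partial_{i,n}x_{i+1,n}=1_n$; $\partial_{i,n}x_{i,n}-x_{i+1,n}\partial_{i,n}=1_n$; (3) $v_{i,n}x_{j,n}=x_{j,n-1}v_{i,n}$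 if $i>j$; $v_{i,n}x_{j,n}=x_{j-1,n-1}v_{i,n}$ if $i<j$; $v_{i,n}\partial_{j,n}=\partial_{j,n-1}v_{i,n}$ if $i>j+1$; $v_{i,n}\partial_{j,n}=\partial_{j-1,n-1}v_{i,n}$ if $i<j$; $v_{i,n}v_{j,n+1}=v_{j,n}v_{i+1,n+1}$ if $i\ge j$; $v_{i,n}\partial_{i,n}=v_{i+1,n}\partial_{i,n}$. Put $\widetilde{NH}{}^m_n=1_m\widetilde{NH}1_n$ (zero if $n<m$). Horizontal concatenation $\odot:\widetilde{NH}{}^m_n\times\widetilde{NH}{}^{m'}_{n'}\to\widetilde{NH}{}^{m+m'}_{n+n'}$ is the bilinear associative operation compatible with products, with $1_a\odot 1_b=1_{a+b}$, $1_a\odot x_{i,n}\odot 1_b=x_{a+i,a+n+b}$, $1_a\odot\partial_{i,n}\odot 1_b=\partial_{a+i,a+n+b}$, $1_a\odot v_{i,n}\odot 1_b=v_{a+i,a+n+b}$, and $a\odot b=(a\odot 1_{m'})(1_n\odot b)$. $NH_k$ is the nilHecke algebra over $\mathbb{Z}$ with generators $x_i,\partial_i$ satisfying relations (2) with the index $n=k$ dropped; it maps to $\widetilde{NH}{}^k_k$ by $x_i\mapsto x_{i,k}$, $\partial_i\mapsto\partial_{i,k}$, and elements of $NH_k$ are identified with their images. For $k\ge0$, $\mathcal{F}^k=\bigoplus_{m\ge 0,\,n\ge k}\widetilde{NH}{}^m_n$ with $\widetilde{NH}$-bimodule structure $a\cdot t\cdot b=a\,t\,(b\odot 1_k)$ (this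 is the $k$-th tensor power over $\widetilde{NH}$ of $\mathcal{F}=\mathcal{F}^1$; $\mathcal{F}^0=\widetilde{NH}$). Write $[t]_{f^k}$ for the element of $\mathcal{F}^k$ given by $t$. For $c\in NH_k$, $r(c):\mathcal{F}^k\to\mathcal{F}^k$ is the bimodule map $[t]_{f^k}\mapsto[t(1_{n-k}\odot c)]_{f^k}$, $t\in\widetilde{NH}{}^m_n$. Let $\partial_{(k)}=\partial_{w_0(k)}\in NH_k$ be the product of $\partial_i$'s along a reduced word of the longest element $w_0(k)\in S_k$, and $e_k=x_1^{k-1}x_2^{k-2}\cdots x_{k-1}\partial_{(k)}$, an idempotent ($e_0=1_0$, $e_1=1_1$). $\mathcal{F}^{(k)}$ is the direct summand of $\mathcal{F}^k$ that is the image of the idempotent endomorphism $r(e_k)$. Let $u_k=\sum_{i=1}^k(-1)^{i-1}v_{i,k}\in\widetilde{NH}{}^{k-1}_k$, and let $d(u_k):\mathcal{F}^{(k-1)}\to\mathcal{F}^{(k)}$ be the bimodule map $[t(1_{n+1-k}\odot e_{k-1})]_{f^{k-1}}\mapsto[t(1_{n+1-k}\odot(e_{k-1}u_ke_k))]_{f^k}$ for $t\in\widetilde{NH}{}^m_n$, $n\ge k-1$ (i.e. right multiplication by $u_k$ on the last strands followed by the projection of $\mathcal{F}^k$ onto $\mathcal{F}^{(k)}$). *)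

(* Defs.v *)
From HB Require Import structures.
From mathcomp Require Import all_boot all_order all_algebra zify.
From mathcomp Require Import boolp classical_sets finmap fsbigop.

Set Implicit Arguments.
Unset Strict Implicit.
Unset Printing Implicit Defensive.

Import GRing.Theory.
Local Open Scope ring_scope.
Local Open Scope quotient_scope.

(* MathComp has no non-unital rings, so the Z-algebra NHt is built by hand, as *)
(* the quotient of the ring terms over the generators by the least congruence  *)
(* containing the axioms of non-unital rings and the defining relations.       *)

Inductive label :=
  LI of nat | LD of nat & nat | LX of nat & nat | LV of nat & nat.

Definition admissible (l : label) : bool :=
  match l with
  | LI _ => true
  | LD i n => (1 <= i <= n.-1)%N
  | LX i n | LV i n => (1 <= i <= n)%N
  end.

Definition generator := {l : label | admissible l}.

Inductive term :=
  | TGen of generator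
  | TZero
  | TOpp of term
  | TAdd of term & term
  | TMul of term & term.

(* Out of range indices denote 0; no relation below uses them. *)
Definition tgen (l : label) : term :=
  if insub l is Some g then TGen g else TZero.

Notation tI n := (tgen (LI n)).
Notation tD i n := (tgen (LD i n)).
Notation tX i n := (tgen (LX i n)).
Notation tV i n := (tgen (LV i n)).

Inductive relation : term -> term -> Prop :=
  | rII n : relation (TMul (tI n) (tI n)) (tI n)
  | rII0 n m : n <> m -> relation (TMul (tI n) (tI m)) TZero
  | rID i n : (1 <= i <= n.-1)%N -> relation (TMul (tI n) (tD i n)) (tD i n)
  | rDI i n : (1 <= i <= n.-1)%N -> relation (TMul (tD i n) (tI n)) (tD i n)
  | rIX i n : (1 <= i <= n)%N -> relation (TMul (tI n) (tX i n)) (tX i n)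
  | rXI i n : (1 <= i <= n)%N -> relation (TMul (tX i n) (tI n)) (tX i n)
  | rIV i n : (1 <= i <= n)%N -> relation (TMul (tI n.-1) (tV i n)) (tV i n)
  | rVI i n : (1 <= i <= n)%N -> relation (TMul (tV i n) (tI n)) (tV i n)
  | rXX i j n : (1 <= i <= n)%N -> (1 <= j <= n)%N ->
      relation (TMul (tX i n) (tX j n)) (TMul (tX j n) (tX i n))
  | rXD i j n : (1 <= i <= n)%N -> (1 <= j <= n.-1)%N ->
      i <> j -> i <> j.+1 ->
      relation (TMul (tX i n) (tD j n)) (TMul (tD j n) (tX i n))
  | rDD i j n : (1 <= i <= n.-1)%N -> (1 <= j <= n.-1)%N ->
      (i.+1 < j)%N || (j.+1 < i)%N ->
      relation (TMul (tD i n) (tD j n)) (TMul (tD j n) (tD i n))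
  | rDD0 i n : (1 <= i <= n.-1)%N -> relation (TMul (tD i n) (tD i n)) TZero
  | rDDD i n : (1 <= i <= n.-1)%N -> (1 <= i.+1 <= n.-1)%N ->
      relation (TMul (TMul (tD i n) (tD i.+1 n)) (tD i n))
               (TMul (TMul (tD i.+1 n) (tD i n)) (tD i.+1 n))
  | rXDDX i n : (1 <= i <= n.-1)%N ->
      relation (TAdd (TMul (tX i n) (tD i n))
                     (TOpp (TMul (tD i n) (tX i.+1 n)))) (tI n)
  | rDXXD i n : (1 <= i <= n.-1)%N ->
      relation (TAdd (TMul (tD i n) (tX i n))
                     (TOpp (TMul (tX i.+1 n) (tD i n)))) (tI n)
  | rVX_gt i j n : (1 <= i <= n)%N -> (1 <= j <= n)%N -> (j < i)%N ->
      relation (TMul (tV i n) (tX j n)) (TMul (tX j n.-1) (tV i n))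
  | rVX_lt i j n : (1 <= i <= n)%N -> (1 <= j <= n)%N -> (i < j)%N ->
      relation (TMul (tV i n) (tX j n)) (TMul (tX j.-1 n.-1) (tV i n))
  | rVD_gt i j n : (1 <= i <= n)%N -> (1 <= j <= n.-1)%N -> (j.+1 < i)%N ->
      relation (TMul (tV i n) (tD j n)) (TMul (tD j n.-1) (tV i n))
  | rVD_lt i j n : (1 <= i <= n)%N -> (1 <= j <= n.-1)%N -> (i < j)%N ->
      relation (TMul (tV i n) (tD j n)) (TMul (tD j.-1 n.-1) (tV i n))
  | rVV i j n : (1 <= i <= n)%N -> (1 <= j <= n)%N -> (j <= i)%N ->
      relation (TMul (tV i n) (tV j n.+1)) (TMul (tV j n) (tV i.+1 n.+1))
  | rVD_eq i n : (1 <= i <= n.-1)%N ->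
      relation (TMul (tV i n) (tD i n)) (TMul (tV i.+1 n) (tD i n)).

Inductive cong : term -> term -> Prop :=
  | c_rel a b : relation a b -> cong a b
  | c_refl a : cong a a
  | c_sym a b : cong a b -> cong b a
  | c_trans b a c : cong a b -> cong b c -> cong a c
  | c_opp a a' : cong a a' -> cong (TOpp a) (TOpp a')
  | c_add a a' b b' : cong a a' -> cong b b' -> cong (TAdd a b) (TAdd a' b')
  | c_mul a a' b b' : cong a a' -> cong b b' -> cong (TMul a b) (TMul a' b')
  | c_addA a b c : cong (TAdd a (TAdd b c)) (TAdd (TAdd a b) c)
  | c_addC a b : cong (TAdd a b) (TAdd b a)
  | c_add0 a : cong (TAdd TZero a) a
  | c_addN a : cong (TAdd (TOpp a) a) TZero
  | c_mulA a b c : cong (TMul a (TMul b c)) (TMul (TMul a b) c)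
  | c_mulDl a b c : cong (TMul (TAdd a b) c) (TAdd (TMul a c) (TMul b c))
  | c_mulDr a b c : cong (TMul a (TAdd b c)) (TAdd (TMul a b) (TMul a c)).

HB.instance Definition _ := gen_eqMixin term.
HB.instance Definition _ := gen_choiceMixin term.

Definition congb : rel term := fun a b => `[< cong a b >].

Lemma congb_equiv : equiv_class_of congb.
Proof.
split=> [a|a b|b a c].
- exact/asboolP/c_refl.
- by apply/asboolP/asboolP => /c_sym.
- by move=> /asboolP ab /asboolP bc; apply/asboolP/(c_trans ab bc).
Qed.
Canonical congb_equivRel := EquivRelPack congb_equiv.

Definition NHt := {eq_quot congb}.
HB.instance Definition _ := Choice.on NHt.

Definition cls (a : term) : NHt := \pi_NHt a.

Lemma clsP a b : cls a = cls b <-> cong a b.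
Proof.
split; first by move=> /eqmodP /asboolP.
by move=> ab; apply/eqmodP/asboolP.
Qed.

Lemma cls_surj (u : NHt) : exists a, u = cls a.
Proof. by exists (repr u); rewrite /cls reprK. Qed.

Lemma repr_cls a : cong (repr (cls a)) a.
Proof. by apply/clsP; rewrite /cls reprK. Qed.

Definition NHt0 : NHt := cls TZero.
Definition NHt_opp (u : NHt) : NHt := cls (TOpp (repr u)).
Definition NHt_add (u v : NHt) : NHt := cls (TAdd (repr u) (repr v)).
Definition NHt_mul (u v : NHt) : NHt := cls (TMul (repr u) (repr v)).

Lemma cls_opp a : NHt_opp (cls a) = cls (TOpp a).
Proof. exact/clsP/c_opp/repr_cls. Qed.
Lemma cls_add a b : NHt_add (cls a) (cls b) = cls (TAdd a b).
Proof. by apply/clsP/c_add; apply: repr_cls. Qed.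
Lemma cls_mul a b : NHt_mul (cls a) (cls b) = cls (TMul a b).
Proof. by apply/clsP/c_mul; apply: repr_cls. Qed.

Lemma NHt_addA : associative NHt_add.
Proof.
move=> u v w.
case: (cls_surj u) (cls_surj v) (cls_surj w) => [a ->] [b ->] [c ->].
by rewrite !cls_add; apply/clsP/c_addA.
Qed.
Lemma NHt_addC : commutative NHt_add.
Proof.
move=> u v.
case: (cls_surj u) (cls_surj v) => [a ->] [b ->].
by rewrite !cls_add; apply/clsP/c_addC.
Qed.
Lemma NHt_add0 : left_id NHt0 NHt_add.
Proof. by move=> u; have [a ->] := cls_surj u; rewrite cls_add; apply/clsP/c_add0. Qed.
Lemma NHt_addN : left_inverse NHt0 NHt_opp NHt_add.
Proof.
by move=> u; have [a ->] := cls_surj u; rewrite cls_opp cls_add; apply/clsP/c_addN.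
Qed.

HB.instance Definition _ :=
  GRing.isZmodule.Build NHt NHt_addA NHt_addC NHt_add0 NHt_addN.

Infix "**" := NHt_mul (at level 40, left associativity) : ring_scope.

Lemma NHt_mulA : associative NHt_mul.
Proof.
move=> u v w.
case: (cls_surj u) (cls_surj v) (cls_surj w) => [a ->] [b ->] [c ->].
by rewrite !cls_mul; apply/clsP/c_mulA.
Qed.
Lemma NHt_mulDl (u v w : NHt) : (u + v) ** w = u ** w + v ** w.
Proof.
case: (cls_surj u) (cls_surj v) (cls_surj w) => [a ->] [b ->] [c ->].
by rewrite /GRing.add /= !(cls_add, cls_mul); apply/clsP/c_mulDl.
Qed.
Lemma NHt_mulDr (u v w : NHt) : u ** (v + w) = u ** v + u ** w.
Proof.
case: (cls_surj u) (cls_surj v) (cls_surj w) => [a ->] [b ->] [c ->].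
by rewrite /GRing.add /= !(cls_add, cls_mul); apply/clsP/c_mulDr.
Qed.

Lemma clsN t : - cls t = cls (TOpp t). Proof. exact: cls_opp. Qed.
Lemma clsD t u : cls t + cls u = cls (TAdd t u). Proof. exact: cls_add. Qed.

Lemma NHt_mul0l (u : NHt) : 0 ** u = 0.
Proof. by apply: (@addrI _ (0 ** u)); rewrite -NHt_mulDl !addr0. Qed.
Lemma NHt_mul0r (u : NHt) : u ** 0 = 0.
Proof. by apply: (@addrI _ (u ** 0)); rewrite -NHt_mulDr !addr0. Qed.
Lemma NHt_mulNl (u v : NHt) : (- u) ** v = - (u ** v).
Proof. by apply: (@addrI _ (u ** v)); rewrite -NHt_mulDl !subrr NHt_mul0l. Qed.
Lemma NHt_mulNr (u v : NHt) : u ** (- v) = - (u ** v).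
Proof. by apply: (@addrI _ (u ** v)); rewrite -NHt_mulDr !subrr NHt_mul0r. Qed.
Lemma NHt_mul_suml (I : Type) (s : seq I) (P : pred I) (f : I -> NHt) u :
  (\sum_(i <- s | P i) f i) ** u = \sum_(i <- s | P i) f i ** u.
Proof.
by apply: (big_morph (NHt_mul^~ u)) => [x y|]; rewrite ?NHt_mulDl ?NHt_mul0l.
Qed.
Lemma NHt_mul_sumr (I : Type) (s : seq I) (P : pred I) (f : I -> NHt) u :
  u ** (\sum_(i <- s | P i) f i) = \sum_(i <- s | P i) u ** f i.
Proof.
by apply: (big_morph (NHt_mul u)) => [x y|]; rewrite ?NHt_mulDr ?NHt_mul0r.
Qed.

Definition NI n : NHt := cls (tI n).
Definition ND i n : NHt := cls (tD i n).
Definition NX i n : NHt := cls (tX i n).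
Definition NV i n : NHt := cls (tV i n).

(* the subgroup 1_m NHt 1_n *)
Definition NHmn m n (u : NHt) : Prop := exists t, u = NI m ** t ** NI n.

(* Writing (.) for horizontal concatenation, [whisk a b] is the additive and    *)
(* multiplicative map u |-> 1_a (.) u (.) 1_b. Only these instances of (.) are  *)
(* needed; in general u (.) v = whisk 0 m' u ** whisk n 0 v for u in            *)
(* 1_m NHt 1_n and v in 1_m' NHt 1_n'.                                          *)
Definition wlabel a b (l : label) : label :=
  match l with
  | LI n => LI (a + n + b)
  | LD i n => LD (a + i) (a + n + b)
  | LX i n => LX (a + i) (a + n + b)
  | LV i n => LV (a + i) (a + n + b)
  end.

Fixpoint twhisk a b (t : term) : term :=
  match t with
  | TGen g => tgen (wlabel a b (val g))
  | TZero => TZero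
  | TOpp t => TOpp (twhisk a b t)
  | TAdd t u => TAdd (twhisk a b t) (twhisk a b u)
  | TMul t u => TMul (twhisk a b t) (twhisk a b u)
  end.

Definition whisk a b (u : NHt) : NHt := cls (twhisk a b (repr u)).

Lemma twhisk_gen a b l :
  admissible l -> twhisk a b (tgen l) = tgen (wlabel a b l).
Proof. by move=> h; rewrite /tgen insubT. Qed.

Lemma twhisk_rel a b t u :
  relation t u -> cong (twhisk a b t) (twhisk a b u).
Proof.
case => *; rewrite /= ?twhisk_gen //=; try lia; apply: c_rel;
  rewrite ?addnS ?addSn;
  repeat match goal with
  | |- context [(a + ?p.-1 + b)%N] =>
      have -> : (a + p.-1 + b = (a + p + b).-1)%N by lia
  | |- context [(a + ?p.-1)%N] => have -> : (a + p.-1 = (a + p).-1)%N by lia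
  end; by constructor; lia.
Qed.

Lemma twhisk_cong a b t u : cong t u -> cong (twhisk a b t) (twhisk a b u).
Proof.
by elim=> /= *; [exact: twhisk_rel | econstructor; eassumption ..].
Qed.

Lemma whisk_cls a b t : whisk a b (cls t) = cls (twhisk a b t).
Proof. exact/clsP/twhisk_cong/repr_cls. Qed.

Lemma whisk0 a b : whisk a b 0 = 0.
Proof. exact: whisk_cls. Qed.
Lemma whiskN a b u : whisk a b (- u) = - whisk a b u.
Proof.
case: (cls_surj u) => [t ->].
by rewrite clsN !whisk_cls clsN.
Qed.
Lemma whiskD a b : {morph whisk a b : u v / u + v}.
Proof.
move=> u v; case: (cls_surj u) (cls_surj v) => [t ->] [s ->].
by rewrite clsD !whisk_cls clsD.
Qed.
Lemma whiskM a b : {morph whisk a b : u v / u ** v}.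
Proof.
move=> u v; case: (cls_surj u) (cls_surj v) => [t ->] [s ->].
by rewrite cls_mul !whisk_cls cls_mul.
Qed.
Lemma whiskI a b n : whisk a b (NI n) = NI (a + n + b).
Proof. by rewrite whisk_cls twhisk_gen. Qed.
Lemma whisk_gen a b l : admissible l ->
  whisk a b (cls (tgen l)) = cls (tgen (wlabel a b l)).
Proof. by move=> h; rewrite whisk_cls twhisk_gen. Qed.
Lemma whisk_sum a b (I : Type) (s : seq I) (P : pred I) (f : I -> NHt) :
  whisk a b (\sum_(i <- s | P i) f i) = \sum_(i <- s | P i) whisk a b (f i).
Proof. exact: (big_morph _ (whiskD a b) (whisk0 a b)). Qed.

Lemma NHt_ind (P : NHt -> Prop) :
  (forall l, admissible l -> P (cls (tgen l))) -> P 0 ->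
  (forall u, P u -> P (- u)) ->
  (forall u v, P u -> P v -> P (u + v)) ->
  (forall u v, P u -> P v -> P (u ** v)) -> forall u, P u.
Proof.
move=> Pg P0 PN PD PM u; case: (cls_surj u) => t ->.
elim: t => [[l hl]| |t Pt|t Pt s Ps|t Pt s Ps].
- by have := Pg l hl; rewrite /tgen insubT.
- exact: P0.
- by rewrite -clsN; apply: PN.
- by rewrite -clsD; apply: PD.
- by rewrite -cls_mul; apply: PM.
Qed.

Definition tgt (l : label) : nat :=
  match l with LI n | LD _ n | LX _ n => n | LV _ n => n.-1 end.
Definition src (l : label) : nat :=
  match l with LI n | LD _ n | LX _ n | LV _ n => n end.

Lemma NI_mul m n : NI m ** NI n = if m == n then NI n else 0.
Proof.
rewrite cls_mul; case: eqP => [->|mn].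
  exact/(clsP _ (tI n))/c_rel/rII.
exact/(clsP _ TZero)/c_rel/rII0.
Qed.

Lemma NI_tgt l : admissible l -> NI (tgt l) ** cls (tgen l) = cls (tgen l).
Proof.
by move=> h; rewrite cls_mul; apply/clsP/c_rel; case: l h => *; constructor.
Qed.

Lemma NI_src l : admissible l -> cls (tgen l) ** NI (src l) = cls (tgen l).
Proof.
by move=> h; rewrite cls_mul; apply/clsP/c_rel; case: l h => *; constructor.
Qed.

Lemma NI_sum_l p (u : NHt) N : (p < N)%N ->
  \sum_(n < N) NI n ** (NI p ** u) = NI p ** u.
Proof.
move=> pN; rewrite (bigD1 (Ordinal pN)) //= NHt_mulA NI_mul eqxx big1 ?addr0 //.
move=> i /eqP ip; rewrite NHt_mulA NI_mul ifF ?NHt_mul0l //.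
by apply/negbTE/eqP => e; apply: ip; apply: val_inj.
Qed.

Lemma NI_sum_r p (u : NHt) N : (p < N)%N ->
  \sum_(n < N) u ** NI p ** NI n = u ** NI p.
Proof.
move=> pN; rewrite (bigD1 (Ordinal pN)) //= -NHt_mulA NI_mul eqxx big1 ?addr0 //.
move=> i /eqP ip; rewrite -NHt_mulA NI_mul ifF ?NHt_mul0r //.
by apply/negbTE/eqP => e; apply: ip; apply: val_inj.
Qed.

Lemma NHt_unitl (u : NHt) :
  exists N, forall M, (N <= M)%N -> \sum_(n < M) NI n ** u = u.
Proof.
elim/NHt_ind: u => [l hl||u [N uN]|u v [N uN] [N' vN]|u v [N uN] _].
- by exists (tgt l).+1 => M lM; rewrite -(NI_tgt hl) NI_sum_l.
- by exists 0%N => M _; rewrite big1 // => i _; rewrite NHt_mul0r.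
- exists N => M /uN {2}<-; rewrite -sumrN.
  by apply: eq_bigr => i _; rewrite NHt_mulNr.
- exists (maxn N N') => M; rewrite geq_max => /andP[/uN {2}<- /vN {2}<-].
  by rewrite -big_split; apply: eq_bigr => i _; rewrite NHt_mulDr.
- exists N => M /uN {2}<-; rewrite NHt_mul_suml.
  by apply: eq_bigr => i _; rewrite NHt_mulA.
Qed.

Lemma NHt_unitr (u : NHt) :
  exists N, forall M, (N <= M)%N -> \sum_(n < M) u ** NI n = u.
Proof.
elim/NHt_ind: u => [l hl||u [N uN]|u v [N uN] [N' vN]|u v _ [N uN]].
- by exists (src l).+1 => M lM; rewrite -(NI_src hl) NI_sum_r.
- by exists 0%N => M _; rewrite big1 // => i _; rewrite NHt_mul0l.
- exists N => M /uN {2}<-; rewrite -sumrN.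
  by apply: eq_bigr => i _; rewrite NHt_mulNl.
- exists (maxn N N') => M; rewrite geq_max => /andP[/uN {2}<- /vN {2}<-].
  by rewrite -big_split; apply: eq_bigr => i _; rewrite NHt_mulDl.
- exists N => M /uN {2}<-; rewrite NHt_mul_sumr.
  by apply: eq_bigr => i _; rewrite NHt_mulA.
Qed.

Lemma NHt_bound (u : NHt) : exists N, forall n, (N <= n)%N -> u ** NI n = 0.
Proof.
have [N uN] := NHt_unitr u; exists N => n Nn.
have := uN n.+1 (leqW Nn); rewrite big_ord_recr /= uN // => /eqP.
by rewrite -subr_eq0 addrAC subrr add0r => /eqP.
Qed.

Definition pr m n (u : NHt) : NHt := NI m ** u ** NI n.

Lemma pr_sum (u : NHt) :
  exists N, u = \sum_(m < N) \sum_(n < N) pr m n u.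
Proof.
have [[N uN] [N' uN']] := (NHt_unitl u, NHt_unitr u).
pose M := maxn N N'; exists M.
have h1 := uN M (leq_maxl _ _); have h2 := uN' M (leq_maxr _ _).
rewrite -{1}h1; apply: eq_bigr => m _; rewrite -{1}h2 NHt_mul_sumr.
by apply: eq_bigr => n _; rewrite /pr NHt_mulA.
Qed.

Lemma prM m n (u v : NHt) :
  exists N, pr m n (u ** v) = \sum_(p < N) pr m p u ** pr p n v.
Proof.
have [N uN] := NHt_unitr u; exists N; rewrite /pr -{1}(uN N) //.
rewrite NHt_mul_suml NHt_mul_sumr NHt_mul_suml; apply: eq_bigr => p _.
rewrite !NHt_mulA; congr (_ ** _ ** _).
by rewrite -[in RHS]NHt_mulA NI_mul eqxx.
Qed.

Lemma pr0 m n : pr m n 0 = 0. Proof. by rewrite /pr NHt_mul0r NHt_mul0l. Qed.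
Lemma prN m n u : pr m n (- u) = - pr m n u.
Proof. by rewrite /pr NHt_mulNr NHt_mulNl. Qed.
Lemma prD m n u v : pr m n (u + v) = pr m n u + pr m n v.
Proof. by rewrite /pr NHt_mulDr NHt_mulDl. Qed.

Lemma pr_gen m n l : admissible l ->
  pr m n (cls (tgen l)) =
  if (m == tgt l) && (n == src l) then cls (tgen l) else 0.
Proof.
move=> h; rewrite /pr -{1}(NI_tgt h) -{1}(NI_src h) !NHt_mulA NI_mul.
case: (m =P _) => [_|_] /=; last by rewrite !NHt_mul0l.
rewrite -NHt_mulA NI_mul eq_sym; case: (n =P _) => [->|_]; last first.
  by rewrite NHt_mul0r.
by rewrite NI_tgt ?NI_src.
Qed.

Lemma NHt_interchange_gen l l' : admissible l -> admissible l' ->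
  whisk 0 (tgt l') (cls (tgen l)) ** whisk (src l) 0 (cls (tgen l')) =
  whisk (tgt l) 0 (cls (tgen l')) ** whisk 0 (src l') (cls (tgen l)).
Proof.
move=> h h'; rewrite !whisk_gen // !cls_mul; apply/clsP.
case: l l' h h' => [n|i n|i n|i n] [n'|i' n'|i' n'|i' n'] //= h h';
 rewrite ?addn0 ?add0n.
- exact: c_refl.
- apply: (c_trans (c_rel (rID _)) (c_sym (c_rel (rDI _)))); lia.
- apply: (c_trans (c_rel (rIX _)) (c_sym (c_rel (rXI _)))); lia.
- have -> : (n + n'.-1 = (n + n').-1)%N by lia.
  apply: (c_trans (c_rel (rIV _)) (c_sym (c_rel (rVI _)))); lia.
- apply: (c_trans (c_rel (rDI _)) (c_sym (c_rel (rID _)))); lia.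
- by apply/c_rel/rDD; lia.
- by apply/c_sym/c_rel/rXD; lia.
- have -> : (n + n'.-1 = (n + n').-1)%N by lia.
  by apply/c_sym/c_rel/rVD_gt; lia.
- apply: (c_trans (c_rel (rXI _)) (c_sym (c_rel (rIX _)))); lia.
- by apply/c_rel/rXD; lia.
- by apply/c_rel/rXX; lia.
- have -> : (n + n'.-1 = (n + n').-1)%N by lia.
  by apply/c_sym/c_rel/rVX_gt; lia.
- have -> : (n.-1 + n' = (n + n').-1)%N by lia.
  apply: (c_trans (c_rel (rVI _)) (c_sym (c_rel (rIV _)))); lia.
- have -> : (n.-1 + n' = (n + n').-1)%N by lia.
  have -> : (n.-1 + i' = (n + i').-1)%N by lia.
  by apply/c_rel/rVD_lt; lia.
- have -> : (n.-1 + n' = (n + n').-1)%N by lia.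
  have -> : (n.-1 + i' = (n + i').-1)%N by lia.
  by apply/c_rel/rVX_lt; lia.
- have -> : (n + n' = (n + n').-1.+1)%N by lia.
  have -> : (n + i' = (n.-1 + i').+1)%N by lia.
  have -> : (n.-1 + n' = (n + n').-1)%N by lia.
  have -> : (n + n'.-1 = (n + n').-1)%N by lia.
  by apply/c_sym/c_rel/rVV; lia.
Qed.

Lemma NHt_interchange b c m j k l :
  whisk 0 k (pr m j b) ** whisk j 0 (pr k l c) =
  whisk m 0 (pr k l c) ** whisk 0 l (pr m j b).
Proof.
elim/NHt_ind: b m j k l => [g hg||u IH|u v IHu IHv|u v IHu IHv] m j k l.
- rewrite pr_gen //; case: andP => [[/eqP-> /eqP->]|_]; last first.
    by rewrite !whisk0 NHt_mul0l NHt_mul0r.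
  elim/NHt_ind: c k l => [g' hg'||u IH|u v IHu IHv|u v IHu IHv] k l.
  + rewrite pr_gen //; case: andP => [[/eqP-> /eqP->]|_]; last first.
      by rewrite !whisk0 NHt_mul0l NHt_mul0r.
    exact: NHt_interchange_gen.
  + by rewrite pr0 !whisk0 NHt_mul0l NHt_mul0r.
  + by rewrite prN !whiskN NHt_mulNl NHt_mulNr IH.
  + by rewrite prD !whiskD NHt_mulDl NHt_mulDr IHu IHv.
  + have [N ->] := prM k l u v.
    rewrite !whisk_sum NHt_mul_sumr NHt_mul_suml; apply: eq_bigr => p _.
    rewrite (whiskM _ _ (pr k p u)) (whiskM _ _ (pr k p u) (pr p l v)).
    by rewrite NHt_mulA IHu -NHt_mulA IHv NHt_mulA.
- by rewrite pr0 !whisk0 NHt_mul0l NHt_mul0r.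
- by rewrite prN !whiskN NHt_mulNl NHt_mulNr IH.
- by rewrite prD !whiskD NHt_mulDl NHt_mulDr IHu IHv.
- have [N ->] := prM m j u v.
  rewrite !whisk_sum NHt_mul_sumr NHt_mul_suml; apply: eq_bigr => p _.
  rewrite (whiskM _ _ (pr m p u)) (whiskM _ _ (pr m p u) (pr p j v)).
  by rewrite -NHt_mulA IHv NHt_mulA IHu NHt_mulA.
Qed.

Record zsub (V : zmodType) := ZSub {
  zs_pred :> V -> Prop;
  zs_0 : zs_pred 0;
  zs_B : forall x y, zs_pred x -> zs_pred y -> zs_pred (x - y) }.

Definition zs_mem (V : zmodType) (S : zsub V) : {pred V} :=
  fun x => `[< S x >].

Lemma zs_mem_closed (V : zmodType) (S : zsub V) : zmod_closed (zs_mem S).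
Proof.
split=> [|x y /asboolP Sx /asboolP Sy]; apply/asboolP; first exact: zs_0.
exact: zs_B.
Qed.
HB.instance Definition _ (V : zmodType) (S : zsub V) :=
  GRing.isZmodClosed.Build V (zs_mem S) (zs_mem_closed S).

Record zs_type (V : zmodType) (S : zsub V) :=
  ZSubElt { zs_val : V; _ : zs_val \in zs_mem S }.
HB.instance Definition _ (V : zmodType) (S : zsub V) :=
  [isSub for @zs_val V S].
HB.instance Definition _ (V : zmodType) (S : zsub V) :=
  [Choice of zs_type S by <:].
HB.instance Definition _ (V : zmodType) (S : zsub V) :=
  [SubChoice_isSubZmodule of zs_type S by <:].

Lemma zs_valP (V : zmodType) (S : zsub V) (x : zs_type S) : S (zs_val x).
Proof. by case: x => x /= /asboolP. Qed.

Definition zs_elt (V : zmodType) (S : zsub V) (x : V) (Sx : S x) : zs_type S :=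
  ZSubElt (asboolT Sx : x \in zs_mem S).

(* Bimodules over NHt; the last two axioms say that the bimodule is unital,    *)
(* that is, the sum of its subgroups 1_m M 1_n.                                *)
Record bimodule := Bimodule {
  bcar :> zmodType;
  lact : NHt -> bcar -> bcar;
  ract : bcar -> NHt -> bcar;
  lactDl : forall a b x, lact (a + b) x = lact a x + lact b x;
  lactDr : forall a x y, lact a (x + y) = lact a x + lact a y;
  lactM : forall a b x, lact (a ** b) x = lact a (lact b x);
  ractDl : forall x y a, ract (x + y) a = ract x a + ract y a;
  ractDr : forall x a b, ract x (a + b) = ract x a + ract x b;
  ractM : forall x a b, ract x (a ** b) = ract (ract x a) b;
  lractA : forall a x b, ract (lact a x) b = lact a (ract x b);
  lact_unital : forall x, exists N, x = \sum_(n < N) lact (NI n) x;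
  ract_unital : forall x, exists N, x = \sum_(n < N) ract x (NI n) }.

Record bimodHom (M N : bimodule) := BimodHom {
  bfun :> M -> N;
  bfunD : forall x y, bfun (x + y) = bfun x + bfun y;
  bfunL : forall a x, bfun (lact a x) = lact a (bfun x);
  bfunR : forall x a, bfun (ract x a) = ract (bfun x) a }.

Lemma lact_x0 (M : bimodule) a : lact a (0 : M) = 0.
Proof. by apply: (@addrI _ (lact a 0)); rewrite -lactDr !addr0. Qed.
Lemma ract_x0 (M : bimodule) a : ract (0 : M) a = 0.
Proof. by apply: (@addrI _ (ract 0 a)); rewrite -ractDl !addr0. Qed.

Section BimodHomTheory.
Variables (M N P : bimodule).

Lemma bfun0 (f : bimodHom M N) : f 0 = 0.
Proof. by apply: (@addrI _ (f 0)); rewrite -bfunD !addr0. Qed.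
Lemma bfunN (f : bimodHom M N) x : f (- x) = - f x.
Proof. by apply: (@addrI _ (f x)); rewrite -bfunD !subrr bfun0. Qed.

Definition bcomp (g : bimodHom N P) (f : bimodHom M N) : bimodHom M P.
Proof.
exists (fun x => g (f x)) => [x y|a x|x a].
- by rewrite !bfunD.
- by rewrite !bfunL.
- by rewrite !bfunR.
Defined.

Definition bzero : bimodHom M N.
Proof.
by exists (fun=> 0) => *; rewrite ?addr0 ?lact_x0 ?ract_x0.
Defined.
End BimodHomTheory.

Definition bimod0 : bimodule.
Proof.
have E (x y : 'rV[int]_0) : x = y by rewrite [x]thinmx0 [y]thinmx0.
by exists 'rV[int]_0 (fun _ x => x) (fun x _ => x) => *; try exists 0%N; apply: E.
Defined.

Section Image.
Variables (M N : bimodule) (f : bimodHom M N).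

Definition bimg_sub : zsub N.
Proof.
exists (fun y => exists x, y = f x) => [|_ _ [x ->] [y ->]].
  by exists 0; rewrite bfun0.
by exists (x - y); rewrite bfunD bfunN.
Defined.

Lemma bimg_lact a (y : zs_type bimg_sub) : bimg_sub (lact a (zs_val y)).
Proof. by case: (zs_valP y) => x ->; exists (lact a x); rewrite bfunL. Qed.
Lemma bimg_ract a (y : zs_type bimg_sub) : bimg_sub (ract (zs_val y) a).
Proof. by case: (zs_valP y) => x ->; exists (ract x a); rewrite bfunR. Qed.

Definition bimg : bimodule.
Proof.
exists (zs_type bimg_sub) (fun a y => zs_elt (bimg_lact a y))
   (fun y a => zs_elt (bimg_ract a y)).
- by move=> a b x; apply: val_inj; rewrite /= lactDl.
- by move=> a x y; apply: val_inj; rewrite /= lactDr.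
- by move=> a b x; apply: val_inj; rewrite /= lactM.
- by move=> x y a; apply: val_inj; rewrite /= ractDl.
- by move=> x a b; apply: val_inj; rewrite /= ractDr.
- by move=> x a b; apply: val_inj; rewrite /= ractM.
- by move=> a x b; apply: val_inj; rewrite /= lractA.
- move=> x; have [n xn] := lact_unital (zs_val x); exists n.
  by apply: val_inj; rewrite raddf_sum.
- move=> x; have [n xn] := ract_unital (zs_val x); exists n.
  by apply: val_inj; rewrite raddf_sum.
Defined.

Definition bimg_incl : bimodHom bimg N.
Proof. by exists (fun y : zs_type bimg_sub => zs_val y). Defined.

Definition bimg_proj : bimodHom M bimg.
Proof.
exists (fun x => zs_elt (ex_intro _ x erefl : bimg_sub (f x)) : bimg).
- by move=> x y; apply: val_inj; rewrite /= bfunD.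
- by move=> a x; apply: val_inj; rewrite /= bfunL.
- by move=> x a; apply: val_inj; rewrite /= bfunR.
Defined.
End Image.

(* F^k is realized inside NHt as the (direct) sum of the 1_m NHt 1_n, n >= k. *)
Definition Fpred k (t : NHt) : Prop :=
  exists s : seq NHt,
    (forall u, u \in s -> exists m n, (k <= n)%N /\ NHmn m n u) /\
    t = \sum_(u <- s) u.

Lemma Fpred0 k : Fpred k 0.
Proof. by exists [::]; rewrite big_nil. Qed.

Lemma FpredD k t u : Fpred k t -> Fpred k u -> Fpred k (t + u).
Proof.
move=> [s [hs ->]] [s' [hs' ->]]; exists (s ++ s'); rewrite big_cat; split=> // x.
by rewrite mem_cat => /orP[/hs|/hs'].
Qed.

Lemma FpredN k t : Fpred k t -> Fpred k (- t).
Proof.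
move=> [s [hs ->]]; exists [seq - u | u <- s].
split; last by rewrite big_map sumrN.
move=> _ /mapP[u /hs [m [n [kn [x ->]]]] ->]; exists m, n; split=> //.
by exists (- x); rewrite NHt_mulNr NHt_mulNl.
Qed.

Lemma Fpred_sum k (I : Type) (r : seq I) (P : pred I) (f : I -> NHt) :
  (forall i, P i -> Fpred k (f i)) -> Fpred k (\sum_(i <- r | P i) f i).
Proof.
by move=> h; apply: big_ind => //; [exact: Fpred0 | exact: FpredD].
Qed.

Lemma Fpred_mulI k n u : (k <= n)%N -> Fpred k (u ** NI n).
Proof.
move=> kn; have [N uN] := NHt_unitl u.
rewrite -(uN N) // NHt_mul_suml; apply: Fpred_sum => i _.
exists [:: NI i ** u ** NI n]; rewrite big_seq1; split=> // x.
by rewrite inE => /eqP ->; exists i, n; split=> //; exists u.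
Qed.

Lemma Fpred_ind k (P : NHt -> Prop) : P 0 ->
  (forall t u, P t -> P u -> P (t + u)) ->
  (forall n u, (k <= n)%N -> P (u ** NI n)) ->
  forall t, Fpred k t -> P t.
Proof.
move=> P0 PD PI _ [s [hs ->]]; rewrite big_seq; apply: big_ind => // u /hs.
by move=> [m [n [kn [x ->]]]]; apply: PI.
Qed.

Definition F_sub (k : nat) : zsub NHt.
Proof.
exists (Fpred k) => [|x y hx hy]; first exact: Fpred0.
by apply: FpredD => //; apply: FpredN.
Defined.

Lemma F_lact k a (t : zs_type (F_sub k)) : F_sub k (a ** zs_val t).
Proof.
elim/Fpred_ind: (zs_valP t) => [|x y hx hy|n u kn].
- by rewrite NHt_mul0r; apply: Fpred0.
- by rewrite NHt_mulDr; apply: FpredD.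
- by rewrite NHt_mulA; apply: Fpred_mulI.
Qed.

Lemma F_ract k (t : zs_type (F_sub k)) b : F_sub k (zs_val t ** whisk 0 k b).
Proof.
have [N ->] := pr_sum b; rewrite whisk_sum NHt_mul_sumr.
apply: Fpred_sum => m _; rewrite whisk_sum NHt_mul_sumr.
apply: Fpred_sum => j _; rewrite /pr whiskM whiskI NHt_mulA.
by apply: Fpred_mulI; lia.
Qed.

Lemma F_unital k t : Fpred k t ->
  exists N, forall M, (N <= M)%N -> \sum_(n < M) t ** whisk 0 k (NI n) = t.
Proof.
elim/Fpred_ind=> [|x y [N xN] [N' yN']|n u kn].
- by exists 0%N => M _; rewrite big1 // => i _; rewrite NHt_mul0l.
- exists (maxn N N') => M; rewrite geq_max => /andP[/xN {2}<- /yN' {2}<-].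
  by rewrite -big_split; apply: eq_bigr => i _; rewrite NHt_mulDl.
- exists (n - k).+1 => M kM; rewrite (bigD1 (Ordinal kM)) //= big1 => [|i /eqP ik].
    by rewrite whiskI add0n subnK // -NHt_mulA NI_mul eqxx addr0.
  rewrite whiskI -NHt_mulA NI_mul ifF ?NHt_mul0r //; apply/negbTE/eqP => e.
  by apply: ik; apply: val_inj => /=; lia.
Qed.

Definition F (k : nat) : bimodule.
Proof.
exists (zs_type (F_sub k)) (fun a t => zs_elt (F_lact a t))
  (fun t b => zs_elt (F_ract t b)).
- by move=> a b x; apply: val_inj; rewrite /= NHt_mulDl.
- by move=> a x y; apply: val_inj; rewrite /= NHt_mulDr.
- by move=> a b x; apply: val_inj; rewrite /= NHt_mulA.
- by move=> x y a; apply: val_inj; rewrite /= NHt_mulDl.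
- by move=> x a b; apply: val_inj; rewrite /= whiskD NHt_mulDr.
- by move=> x a b; apply: val_inj; rewrite /= whiskM NHt_mulA.
- by move=> a x b; apply: val_inj; rewrite /= NHt_mulA.
- move=> x; have [N xN] := NHt_unitl (zs_val x); exists N.
  by apply: val_inj; rewrite raddf_sum /= xN.
- move=> x; have [N xN] := F_unital (zs_valP x); exists N.
  by apply: val_inj; rewrite raddf_sum /= xN.
Defined.

Definition F_val k (t : F k) : NHt := zs_val (t : zs_type (F_sub k)).

(* For c in 1_k NHt 1_l, the linear extension of the map sending t in          *)
(* 1_m NHt 1_n to t (1_{n-k} (.) c); all but finitely many terms vanish.        *)
Definition rmul_fun k (c t : NHt) : NHt :=
  \sum_(n \in [set n | (k <= n)%N]%classic) t ** NI n ** whisk (n - k) 0 c.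

Lemma rmul_funE k c t N : (forall n, (N <= n)%N -> t ** NI n = 0) ->
  rmul_fun k c t =
  \sum_(0 <= n < N | (k <= n)%N) t ** NI n ** whisk (n - k) 0 c.
Proof.
move=> tN; have uN : uniq (index_iota 0 N) by exact: iota_uniq.
have e : [set` [pred n | (k <= n)%N]]%classic = [set n | (k <= n)%N]%classic by [].
rewrite (bigfs _ uN) // => i _; rewrite mem_index_iota -leqNgt => /tN ->.
by rewrite NHt_mul0l.
Qed.

Lemma rmul_funD k c t u : rmul_fun k c (t + u) = rmul_fun k c t + rmul_fun k c u.
Proof.
have [[N tN] [N' uN']] := (NHt_bound t, NHt_bound u).
have h1 n : (maxn N N' <= n)%N -> t ** NI n = 0.
  by move=> ?; apply: tN; lia.
have h2 n : (maxn N N' <= n)%N -> u ** NI n = 0.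
  by move=> ?; apply: uN'; lia.
have h n : (maxn N N' <= n)%N -> (t + u) ** NI n = 0.
  by move=> ?; rewrite NHt_mulDl h1 ?h2 ?addr0.
rewrite (rmul_funE _ _ h) (rmul_funE _ _ h1) (rmul_funE _ _ h2) -big_split.
by apply: eq_bigr => n _; rewrite !NHt_mulDl.
Qed.

Lemma rmul_fun0 k c : rmul_fun k c 0 = 0.
Proof. by apply: (@addrI _ (rmul_fun k c 0)); rewrite -rmul_funD !addr0. Qed.

Lemma rmul_fun_homog k c n u : (k <= n)%N ->
  rmul_fun k c (u ** NI n) = u ** NI n ** whisk (n - k) 0 c.
Proof.
move=> kn; rewrite (@rmul_funE _ _ _ n.+1) => [|i ni]; last first.
  by rewrite -NHt_mulA NI_mul ifF ?NHt_mul0r //; apply/negbTE; lia.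
rewrite big_mkcond big_nat_recr //= kn big_nat big1 ?add0r => [|i /andP[_ ni]].
  by rewrite -[u ** _ ** _]NHt_mulA NI_mul eqxx.
case: ifP => // _; rewrite -[u ** _ ** _]NHt_mulA NI_mul ifF ?NHt_mul0r ?NHt_mul0l //.
by apply/negbTE; lia.
Qed.

Lemma NHmn_pr m n u : NHmn m n u -> pr m n u = u.
Proof.
move=> [t ->]; rewrite /pr !NHt_mulA NI_mul eqxx -!NHt_mulA NI_mul eqxx.
by [].
Qed.

Lemma NHmn_row m n u : NHmn m n u -> u ** NI n = u.
Proof. by move=> [t ->]; rewrite -!NHt_mulA NI_mul eqxx. Qed.

Section Rmul.
Variables (k l : nat) (c : NHt) (hc : NHmn k l c).

Lemma rmul_sub (t : F k) : F_sub l (rmul_fun k c (F_val t)).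
Proof.
rewrite /F_val.
elim/Fpred_ind: (zs_valP t) => [|x y hx hy|n u kn].
- by rewrite rmul_fun0; apply: Fpred0.
- by rewrite rmul_funD; apply: FpredD.
- rewrite rmul_fun_homog // -(NHmn_row hc) whiskM whiskI NHt_mulA.
  by apply: Fpred_mulI; lia.
Qed.

Lemma rmul_funL a t : Fpred k t ->
  rmul_fun k c (a ** t) = a ** rmul_fun k c t.
Proof.
elim/Fpred_ind=> [|x y hx hy|n u kn].
- by rewrite NHt_mul0r rmul_fun0 NHt_mul0r.
- by rewrite NHt_mulDr !rmul_funD hx hy NHt_mulDr.
- by rewrite NHt_mulA !rmul_fun_homog // !NHt_mulA.
Qed.

Lemma rmul_fun_sum (I : Type) (s : seq I) (P : pred I) (f : I -> NHt) :
  rmul_fun k c (\sum_(i <- s | P i) f i) = \sum_(i <- s | P i) rmul_fun k c (f i).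
Proof. exact: (big_morph _ (rmul_funD k c) (rmul_fun0 k c)). Qed.

Lemma rmul_funR t b : Fpred k t ->
  rmul_fun k c (t ** whisk 0 k b) = rmul_fun k c t ** whisk 0 l b.
Proof.
elim/Fpred_ind=> [|x y hx hy|n u kn].
- by rewrite NHt_mul0l rmul_fun0 NHt_mul0l.
- by rewrite NHt_mulDl !rmul_funD hx hy NHt_mulDl.
have [N ->] := pr_sum b; rewrite !whisk_sum !NHt_mul_sumr rmul_fun_sum.
apply: eq_bigr => m _; rewrite !whisk_sum !NHt_mul_sumr rmul_fun_sum.
apply: eq_bigr => j _; rewrite rmul_fun_homog //.
have prI : whisk 0 k (pr m j b) = whisk 0 k (pr m j b) ** NI (j + k).
  by rewrite -[(j + k)%N]/(0 + j + k)%N -whiskI -whiskM /pr -!NHt_mulA NI_mul eqxx.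
have prI' p : whisk 0 p (pr m j b) = NI (m + p) ** whisk 0 p (pr m j b).
  by rewrite -[(m + p)%N]/(0 + m + p)%N -whiskI -whiskM /pr !NHt_mulA NI_mul eqxx.
have cI : whisk (n - k) 0 c = whisk (n - k) 0 c ** NI (n - k + l).
  by rewrite -[X in NI X]addn0 -whiskI -whiskM (NHmn_row hc).
have [nm|nm] := (n - k =P m)%N; last first.
  have -> : u ** NI n ** whisk 0 k (pr m j b) = 0.
    rewrite prI' NHt_mulA -[u ** _ ** _]NHt_mulA NI_mul ifF ?NHt_mul0r ?NHt_mul0l //.
    by apply/negbTE/eqP; lia.
  have z : NI (n - k + l) ** NI (m + l) = 0.
    by rewrite NI_mul ifF //; apply/negbTE/eqP; lia.
  rewrite rmul_fun0 prI' cI NHt_mulA.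
  rewrite -[_ ** NI (m + l)]NHt_mulA -[_ ** NI (n - k + l) ** _]NHt_mulA z.
  by rewrite !NHt_mul0r NHt_mul0l.
rewrite prI NHt_mulA rmul_fun_homog ?leq_addl // addnK.
rewrite -(NHt_mulA _ _ (NI _)) -prI -!(NHt_mulA (u ** NI n)).
by have := NHt_interchange b c m j k l; rewrite (NHmn_pr hc) nm => ->.
Qed.
End Rmul.

Definition rmul k l c (hc : NHmn k l c) : bimodHom (F k) (F l).
Proof.
exists (fun t : F k => zs_elt (rmul_sub hc t) : F l).
- by move=> x y; apply: val_inj; rewrite /= /F_val /= rmul_funD.
- by move=> a x; apply: val_inj; exact: (rmul_funL c a (zs_valP (x : zs_type (F_sub k)))).
- by move=> x a; apply: val_inj; exact: (rmul_funR hc a (zs_valP (x : zs_type (F_sub k)))).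
Defined.

Lemma rmulE k l c (hc : NHmn k l c) (t : F k) m n :
  (k <= n)%N -> NHmn m n (F_val t) ->
  F_val (rmul hc t) = F_val t ** whisk (n - k) 0 c.
Proof.
by move=> kn /NHmn_row tn; rewrite {1}/F_val /= -tn rmul_fun_homog // tn.
Qed.

(* The reduced word (1)(2 1)(3 2 1)...(k-1 ... 1) of the longest element. *)
Definition w0word k : seq nat := flatten [seq rev (iota 1 j) | j <- iota 1 k.-1].

Definition adjswap i j : nat :=
  if j == i then i.+1 else if j == i.+1 then i else j.

Lemma w0wordS k : w0word k.+1 = w0word k ++ rev (iota 1 k).
Proof.
case: k => [//|k]; have e : k.+2.-1 = (k + 1)%N by rewrite addn1.
by rewrite {1}/w0word e iotaD map_cat flatten_cat /= cats0.
Qed.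

(* w0word k has length k(k-1)/2 and its product is the permutation             *)
(* j |-> k+1-j of {1, ..., k}: it is a reduced word of the longest element.    *)
Lemma w0word_longest k :
  [/\ all (fun i => 1 <= i <= k.-1)%N (w0word k),
      size (w0word k) = 'C(k, 2) &
      forall j, (1 <= j <= k)%N -> foldr adjswap j (w0word k) = (k.+1 - j)%N].
Proof.
have fix_big s j : all (fun i => i.+1 < j)%N s -> foldr adjswap j s = j.
  elim: s => //= i s IH /andP[ij /IH ->]; rewrite /adjswap.
  by rewrite !ifF //; apply/negbTE; lia.
have cyc n j : (1 <= j <= n.+1)%N ->
    foldr adjswap j (rev (iota 1 n)) = if j == 1%N then n.+1 else j.-1.
  elim: n j => [|n IH] j hj; first by case: j hj => [|[]].
  rewrite -[n.+1]addn1 iotaD add1n rev_cat /=.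
  have [jn|jn] := leqP j n.+1.
    by rewrite IH; last lia; rewrite /adjswap; case: (j =P 1%N) => ?;
      repeat case: ifP => ?; lia.
  rewrite fix_big; last by apply/allP => i; rewrite mem_rev mem_iota; lia.
  by rewrite /adjswap; repeat case: ifP => ?; lia.
elim: k => [|k [IH1 IH2 IH3]]; first by split=> // j; lia.
rewrite w0wordS; split.
- rewrite all_cat all_rev; apply/andP; split.
    by apply: sub_all IH1 => i; lia.
  by apply/allP => i; rewrite mem_iota; lia.
- by rewrite size_cat size_rev size_iota IH2 binS bin1.
- move=> j hj; rewrite foldr_cat cyc //; case: eqP => [->|j1].
    rewrite fix_big ?subSS ?subn0 //.
    by apply: sub_all IH1 => i; lia.
  by rewrite IH3; lia.
Qed.

(* The image of e_k in 1_k NHt 1_k; NI k is the unit of that corner ring.       *)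
Definition ek k : NHt :=
  (\big[NHt_mul/NI k]_(1 <= i < k) iter (k - i) (NHt_mul (NX i k)) (NI k)) **
  (\big[NHt_mul/NI k]_(i <- w0word k) ND i k).

Definition uk k : NHt := \sum_(1 <= i < k.+1) NV i k *~ (-1) ^+ i.-1.

Lemma NHmn_lr m n u : NI m ** u = u -> u ** NI n = u -> NHmn m n u.
Proof. by move=> h1 h2; exists u; rewrite h1 h2. Qed.

Lemma NI_idem n : NI n ** NI n = NI n.
Proof. by rewrite NI_mul eqxx. Qed.

Lemma ek_mn k : NHmn k k (ek k).
Proof.
have L (I : Type) (s : seq I) (P : pred I) f :
    (forall i, P i -> NI k ** f i = f i) ->
    NI k ** (\big[NHt_mul/NI k]_(i <- s | P i) f i) = \big[NHt_mul/NI k]_(i <- s | P i) f i.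
  move=> h; elim: s => [|i s IH]; rewrite ?big_nil ?NI_idem // big_cons.
  by case: ifP => // /h hi; rewrite NHt_mulA hi.
have R (I : Type) (s : seq I) (P : pred I) f :
    (\big[NHt_mul/NI k]_(i <- s | P i) f i) ** NI k = \big[NHt_mul/NI k]_(i <- s | P i) f i.
  elim: s => [|i s IH]; rewrite ?big_nil ?NI_idem // big_cons.
  by case: ifP => // _; rewrite -NHt_mulA IH.
apply: NHmn_lr; rewrite /ek; last by rewrite -NHt_mulA R.
rewrite NHt_mulA; congr (_ ** _); rewrite big_nat_cond; apply: L => i.
rewrite andbT => hi; have -> : (k - i = (k - i).-1.+1)%N by lia.
rewrite iterS NHt_mulA; congr (_ ** _).
by apply: (NI_tgt (l := LX i k)) => /=; lia.
Qed.

Lemma uk_mn k : NHmn k.-1 k (uk k).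
Proof.
apply: NHmn_lr; rewrite /uk.
  rewrite NHt_mul_sumr big_nat [RHS]big_nat; apply: eq_bigr => i hi.
  have h : NI k.-1 ** NV i k = NV i k by apply: (NI_tgt (l := LV i k)) => /=; lia.
  case: (odd i.-1) (signr_odd int i.-1) => <-; rewrite ?mulr1z //.
  by rewrite expr1 !mulrN1z NHt_mulNr h.
rewrite NHt_mul_suml big_nat [RHS]big_nat; apply: eq_bigr => i hi.
have h : NV i k ** NI k = NV i k by apply: (NI_src (l := LV i k)) => /=; lia.
case: (odd i.-1) (signr_odd int i.-1) => <-; rewrite ?mulr1z //.
by rewrite expr1 !mulrN1z NHt_mulNl h.
Qed.

Definition rek k : bimodHom (F k) (F k) := rmul (ek_mn k).
Definition Fdiv k : bimodule := bimg (rek k).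

(* d(u_k): right multiplication by u_k, then the projection r(e_k) of F^k onto *)
(* F^(k); k = 0 is not used.                                                    *)
Definition du k : bimodHom (Fdiv k.-1) (Fdiv k) :=
  bcomp (bimg_proj (rek k)) (bcomp (rmul (uk_mn k)) (bimg_incl (rek k.-1))).

Lemma NHmn_whisk k l c m n t : (k <= n)%N -> NHmn m n t -> NHmn k l c ->
  NHmn m (n - k + l) (t ** whisk (n - k) 0 c).
Proof.
move=> kn [t' ->] hc; apply: NHmn_lr; first by rewrite !NHt_mulA NI_idem.
have {2}<- := NHmn_row hc.
by rewrite whiskM whiskI addn0 !NHt_mulA.
Qed.

(* On [t (1_{n+1-k} (.) e_{k-1})], t in 1_m NHt 1_n, this gives                  *)
(* [t (1_{n+1-k} (.) (e_{k-1} u_k e_k))].                                        *)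
Lemma duE k (t : F k.-1) m n : (1 <= k)%N -> (k.-1 <= n)%N ->
  NHmn m n (F_val t) ->
  F_val (bimg_incl _ (du k (bimg_proj (rek k.-1) t))) =
  F_val t ** whisk (n.+1 - k) 0 (ek k.-1 ** uk k ** ek k).
Proof.
move=> k1 kn tmn; have e1 : (n - k.-1 = n.+1 - k)%N by lia.
have e2 : (n - k.-1 + k.-1 = n)%N by lia.
have e3 : (n - k.-1 + k = n.+1)%N by lia.
have s1 := rmulE (ek_mn k.-1) kn tmn.
have h1 : NHmn m n (F_val (rmul (ek_mn k.-1) t)).
  by rewrite s1 -{1}e2; apply: NHmn_whisk (ek_mn _).
have s2 := rmulE (uk_mn k) kn h1.
have h2 : NHmn m n.+1 (F_val (rmul (uk_mn k) (rmul (ek_mn k.-1) t))).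
  by rewrite s2 -{1}e3; apply: NHmn_whisk (uk_mn _).
have kn' : (k <= n.+1)%N by lia.
rewrite [LHS](rmulE (ek_mn k) kn' h2) s2 s1 e1.
by rewrite -!NHt_mulA -!whiskM !NHt_mulA.
Qed.

(* i + 1, defined by cases so that expF_obj (succz i) reduces *)
Definition succz (i : int) : int :=
  match i with Posz n => Posz n.+1 | Negz 0 => Posz 0 | Negz n.+1 => Negz n end.

Lemma succzE i : succz i = i + 1.
Proof. by case: i => [n|[|n]] //=; lia. Qed.

Record precomplex := Precomplex {
  cobj :> int -> bimodule;
  cdiff : forall i, bimodHom (cobj i) (cobj (succz i)) }.

Definition is_cochain_complex (C : precomplex) : Prop :=
  forall i (x : C i), cdiff C (succz i) (cdiff C i x) = 0.

(* The direct sum of the F^(k)[-k]: its degree i component is F^(i) for        *)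
(* i >= 0 and 0 otherwise.                                                      *)
Definition expF_obj (i : int) : bimodule :=
  if i is Posz k then Fdiv k else bimod0.

Definition expF_diff (i : int) :
    bimodHom (expF_obj i) (expF_obj (succz i)) :=
  match i with
  | Posz k => du k.+1
  | Negz n => bzero _ _
  end.

Definition expF : precomplex := Precomplex expF_diff.

(* Main.v *)
Require Import Defs.
From mathcomp Require Import all_boot all_order all_algebra.
From mathcomp Require Import zify.
Import GRing.Theory.
Local Open Scope ring_scope.

(** The composite sends the class of t (1 (.) e_{k-1}) to that of
    t (1 (.) e_{k-1} u_k e_k u_{k+1} e_{k+1}), so it is enough to show that
    e_{k-1} u_k e_k u_{k+1} e_{k+1} = 0 ([euek_eq0]).

    The element w = e_{k-1} u_k satisfies w ∂_j = 0 for all j ([euk_killed]):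
    in u_k ∂_j the terms of index j and j+1 cancel because
    v_j ∂_j = v_{j+1} ∂_j, and in every other term ∂_j moves to the left of v_i,
    where it is killed by ∂_(k-1) ([ek_ND]).  On such a w right multiplication
    by f ∂_j, for f a polynomial, is right multiplication by the divided
    difference of f; since the longest divided difference of
    x_1^{k-1} ... x_{k-1} is 1, it follows that w e_k = w ([killed_ek]).
    Hence e_{k-1} u_k e_k u_{k+1} = e_{k-1} u_k u_{k+1}, and u_k u_{k+1} = 0
    ([uk_uk]) because v_i v_j = v_j v_{i+1} for j <= i pairs off the terms of
    the double sum with opposite signs. *)

(** * The defining relations as right multiplications *)

Lemma cls_rel a b : relation a b -> cls a = cls b.
Proof. by move=> ab; apply/clsP/c_rel. Qed.

Lemma NX_NI i n : (1 <= i <= n)%N -> NX i n ** NI n = NX i n.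
Proof. by move=> h; rewrite cls_mul; apply/cls_rel/rXI. Qed.

Lemma ND_NI i n : (1 <= i < n)%N -> ND i n ** NI n = ND i n.
Proof. by move=> h; rewrite cls_mul; apply/cls_rel/rDI; lia. Qed.

Lemma mulXX z i j n : (1 <= i <= n)%N -> (1 <= j <= n)%N ->
  z ** NX i n ** NX j n = z ** NX j n ** NX i n.
Proof.
move=> hi hj; rewrite -!NHt_mulA; congr (_ ** _).
by rewrite !cls_mul; apply/cls_rel/rXX.
Qed.

Lemma mulXD z i j n : (1 <= i <= n)%N -> (1 <= j < n)%N -> i <> j -> i <> j.+1 ->
  z ** NX i n ** ND j n = z ** ND j n ** NX i n.
Proof.
move=> hi hj ij ij'; rewrite -!NHt_mulA; congr (_ ** _).
by rewrite !cls_mul; apply/cls_rel/rXD => //; lia.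
Qed.

Lemma mulDD z i j n : (1 <= i < n)%N -> (1 <= j < n)%N ->
  (i.+1 < j)%N || (j.+1 < i)%N -> z ** ND i n ** ND j n = z ** ND j n ** ND i n.
Proof.
move=> hi hj ij; rewrite -!NHt_mulA; congr (_ ** _).
by rewrite !cls_mul; apply/cls_rel/rDD => //; lia.
Qed.

Lemma mulDD0 z i n : (1 <= i < n)%N -> z ** ND i n ** ND i n = 0.
Proof.
move=> h; rewrite -NHt_mulA; suff -> : ND i n ** ND i n = 0 by rewrite NHt_mul0r.
by rewrite cls_mul; apply/cls_rel/rDD0; lia.
Qed.

Lemma mulDDD z i n : (1 <= i)%N -> (i.+1 < n)%N ->
  z ** ND i.+1 n ** ND i n ** ND i.+1 n = z ** ND i n ** ND i.+1 n ** ND i n.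
Proof.
move=> h1 h2; have e : ND i n ** ND i.+1 n ** ND i n =
                       ND i.+1 n ** ND i n ** ND i.+1 n.
  rewrite [ND i n ** ND _ _]cls_mul [ND i.+1 n ** ND _ _]cls_mul !cls_mul.
  by apply: cls_rel; apply: rDDD; lia.
by rewrite -!NHt_mulA !(NHt_mulA (ND _ _)) e.
Qed.

Lemma mulXDl z i n : (1 <= i < n)%N -> z ** NI n = z ->
  z ** NX i n ** ND i n = z ** ND i n ** NX i.+1 n + z.
Proof.
move=> h zn; have e : NX i n ** ND i n - ND i n ** NX i.+1 n = NI n.
  by rewrite !cls_mul clsN clsD; apply: cls_rel; apply: rXDDX; lia.
by rewrite -[in X in _ + X]zn -e NHt_mulDr NHt_mulNr !NHt_mulA addrC subrK.
Qed.

Lemma mulXDr z i n : (1 <= i < n)%N -> z ** NI n = z ->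
  z ** NX i.+1 n ** ND i n = z ** ND i n ** NX i n - z.
Proof.
move=> h zn; have e : ND i n ** NX i n - NX i.+1 n ** ND i n = NI n.
  by rewrite !cls_mul clsN clsD; apply: cls_rel; apply: rDXXD; lia.
by rewrite -[in X in _ - X]zn -e NHt_mulDr NHt_mulNr !NHt_mulA opprB addrC subrK.
Qed.

(** * Right multiplication by e_k *)

Lemma iota1_rcons m : iota 1 m.+1 = rcons (iota 1 m) m.+1.
Proof. by rewrite -[in LHS](addn1 m) iotaD add1n cats1. Qed.

Lemma eq_in_foldl (T : Type) (g h : T -> nat -> T) w s :
  (forall z, {in s, g z =1 h z}) -> foldl g w s = foldl h w s.
Proof.
elim: s w => //= i s IH w gh; rewrite gh ?mem_head //; apply: IH => z j js.
by apply: gh; rewrite inE js orbT.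
Qed.

Lemma foldl_NI n (g : NHt -> nat -> NHt) w s : w ** NI n = w ->
  {in s, forall i z, z ** NI n = z -> g z i ** NI n = g z i} ->
  foldl g w s ** NI n = foldl g w s.
Proof.
elim: s w => //= i s IH w wn gn; apply: IH => [|j js]; last first.
  by apply: gn; rewrite inE js orbT.
by apply: gn => //; rewrite inE eqxx.
Qed.

(** As NI n is not a unit of the whole algebra, the factors of a product are
    absorbed one at a time into an element w with w 1_n = w. *)
Lemma mul_big_foldl n (f : nat -> NHt) (g : NHt -> nat -> NHt) w s :
  w ** NI n = w ->
  {in s, forall i z, z ** NI n = z -> z ** f i = g z i /\ g z i ** NI n = g z i} ->
  w ** (\big[NHt_mul/NI n]_(i <- s) f i) = foldl g w s.
Proof.
elim: s w => [|i s IH] w wn fg; first by rewrite big_nil wn.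
have [e gn] := fg i (mem_head _ _) w wn.
rewrite big_cons NHt_mulA e IH // => j js.
by apply: fg; rewrite inE js orbT.
Qed.

Lemma iter_NX_NI n i m z : (1 <= i <= n)%N -> z ** NI n = z ->
  iter m (NHt_mul^~ (NX i n)) z ** NI n = iter m (NHt_mul^~ (NX i n)) z.
Proof. by move=> hi zn; case: m => //= m; rewrite -NHt_mulA NX_NI. Qed.

Lemma mul_iter n i m z : z ** NI n = z -> (1 <= i <= n)%N ->
  z ** iter m (NHt_mul (NX i n)) (NI n) = iter m (NHt_mul^~ (NX i n)) z.
Proof.
elim: m z => [//|m IH] z zn hi; rewrite iterS NHt_mulA IH // -?iterSr //.
by rewrite -NHt_mulA NX_NI.
Qed.

(** Right multiplication by x_1 ... x_j. *)
Definition mulX n j w := foldl (fun z i => z ** NX i n) w (iota 1 j).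

(** Right multiplication by x_1^{j-1} x_2^{j-2} ... x_j^0. *)
Definition mulXdelta n j w :=
  foldl (fun z i => iter (j - i) (NHt_mul^~ (NX i n)) z) w (iota 1 j).

(** Right multiplication by the longest divided difference ∂_(j). *)
Definition mulDlongest n j w := foldl (fun z i => z ** ND i n) w (w0word j).

Lemma mul_ek n w : w ** NI n = w -> w ** ek n = mulDlongest n n (mulXdelta n n w).
Proof.
move=> wn; rewrite /ek NHt_mulA.
have -> : w ** (\big[NHt_mul/NI n]_(1 <= i < n)
             iter (n - i) (NHt_mul (NX i n)) (NI n)) = mulXdelta n n w.
  rewrite (@mul_big_foldl _ _
    (fun z i => iter (n - i) (NHt_mul^~ (NX i n)) z)) //; last first.
    move=> i; rewrite mem_index_iota => hi z zn.
    have hin : (1 <= i <= n)%N by lia.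
    by rewrite mul_iter // iter_NX_NI.
  rewrite /mulXdelta /index_iota subn1; case: (n) => // m.
  (* the last exponent of x^delta is 0 *)
  by rewrite iota1_rcons foldl_rcons subnn.
apply: mul_big_foldl => [|i /(allP (let: And3 h _ _ := w0word_longest n in h)) hi z zn].
  apply: foldl_NI => // i; rewrite mem_iota => hi z zn.
  by apply: iter_NX_NI => //; lia.
by split=> //; rewrite -NHt_mulA ND_NI //; lia.
Qed.

Lemma iter_mulXX n i j a b z : (1 <= i <= n)%N -> (1 <= j <= n)%N ->
  iter a (NHt_mul^~ (NX i n)) (iter b (NHt_mul^~ (NX j n)) z) =
  iter b (NHt_mul^~ (NX j n)) (iter a (NHt_mul^~ (NX i n)) z).
Proof.
move=> hi hj; elim: a => [//|a IHa]; rewrite !iterS IHa.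
by elim: b {IHa} => [//|b IHb]; rewrite !iterS mulXX // IHb.
Qed.

Lemma foldl_iterS n (m : nat -> nat) s w :
  {in s, forall i, (1 <= i <= n)%N} ->
  foldl (fun z i => iter (m i).+1 (NHt_mul^~ (NX i n)) z) w s =
  foldl (fun z i => iter (m i) (NHt_mul^~ (NX i n)) z)
    (foldl (fun z i => z ** NX i n) w s) s.
Proof.
elim: s w => //= i s IH w hs; have hi := hs i (mem_head _ _).
have hs' : {in s, forall j, (1 <= j <= n)%N}.
  by move=> j js; apply: hs; rewrite inE js orbT.
have comm y : foldl (fun z i => z ** NX i n) (iter (m i) (NHt_mul^~ (NX i n)) y) s =
    iter (m i) (NHt_mul^~ (NX i n)) (foldl (fun z i => z ** NX i n) y s).
  elim: s {IH hs} hs' y => //= j s IH hs y.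
  have hj := hs j (mem_head _ _).
  rewrite -[_ ** NX j n]/(iter 1 (NHt_mul^~ (NX j n)) _) iter_mulXX // IH // => l ls.
  by apply: hs; rewrite inE ls orbT.
by rewrite IH // -comm -iterSr.
Qed.

(** x_1^j ... x_j = (x_1 ... x_j) (x_1^{j-1} ... x_j^0) *)
Lemma mulXdeltaS n j w : (j <= n)%N ->
  mulXdelta n j.+1 w = mulXdelta n j (mulX n j w).
Proof.
move=> jn; rewrite /mulXdelta /mulX -foldl_iterS => [|i]; last first.
  by rewrite mem_iota; lia.
rewrite iota1_rcons foldl_rcons subnn /=.
by apply: eq_in_foldl => z i; rewrite mem_iota => hi; rewrite subSn //; lia.
Qed.

Lemma mulX_NI n j w : (j <= n)%N -> w ** NI n = w ->
  mulX n j w ** NI n = mulX n j w.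
Proof.
move=> jn wn; apply: foldl_NI => // i; rewrite mem_iota => hi z zn.
by rewrite -NHt_mulA NX_NI //; lia.
Qed.

Lemma foldl_mulX_killed n i w s : (1 <= i < n)%N ->
  {in s, forall l, (1 <= l <= n)%N /\ l <> i /\ l <> i.+1} ->
  w ** ND i n = 0 -> foldl (fun z i => z ** NX i n) w s ** ND i n = 0.
Proof.
move=> hi; elim: s w => //= l s IH w hs w0; apply: IH => [j js|].
  by apply: hs; rewrite inE js orbT.
have [hl [li li']] := hs l (mem_head _ _).
by rewrite mulXD // w0 NHt_mul0l.
Qed.

(** x_1 ... x_j is symmetric in x_i and x_{i+1}, hence commutes with ∂_i. *)
Lemma mulX_killed n i j w : (1 <= i < j)%N -> (j <= n)%N -> w ** NI n = w ->
  w ** ND i n = 0 -> mulX n j w ** ND i n = 0.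
Proof.
move=> hi jn wn w0; rewrite /mulX.
have -> : iota 1 j = iota 1 i.-1 ++ [:: i; i.+1] ++ iota i.+2 (j - i.+1).
  have {1}-> : j = (i.-1 + (2 + (j - i.+1)))%N by lia.
  rewrite iotaD; have -> : (1 + i.-1 = i)%N by lia.
  by rewrite iotaD /= addn2.
rewrite !foldl_cat; apply: foldl_mulX_killed; first lia.
  by move=> l; rewrite mem_iota; lia.
set z := foldl _ w _; rewrite /=.
have zn : z ** NI n = z.
  by apply: foldl_NI => // l; rewrite mem_iota => hl y yn; rewrite -NHt_mulA NX_NI //; lia.
have z0 : z ** ND i n = 0.
  by apply: foldl_mulX_killed => // [|l]; rewrite ?mem_iota; lia.
rewrite mulXDr; [|lia|by rewrite -NHt_mulA NX_NI //; lia].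
rewrite mulXDl //; last lia.
by rewrite z0 NHt_mul0l add0r subrr.
Qed.

(** Each ∂_i removes the last remaining factor x_i. *)
Lemma mulX_mulD n j w : (j < n)%N -> w ** NI n = w ->
  (forall i, (1 <= i <= j)%N -> w ** ND i n = 0) ->
  foldl (fun z i => z ** ND i n) (mulX n j w) (rev (iota 1 j)) = w.
Proof.
elim: j => [//|j IH] jn wn w0.
rewrite /mulX iota1_rcons rev_rcons foldl_rcons /= -/(mulX n j w).
rewrite mulXDl; [|lia|by apply: mulX_NI => //; lia].
(* the first summand vanishes since x_1 ... x_j commutes with ∂_{j+1} *)
rewrite foldl_mulX_killed ?NHt_mul0l ?add0r; [|lia| |apply: w0; lia].
  by apply: IH => // [|i hi]; [lia | apply: w0; lia].
by move=> l; rewrite mem_iota; lia.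
Qed.

(** The longest divided difference of x_1^{j-1} ... x_{j-1} is 1. *)
Lemma mulXdelta_mulD n j w : (j <= n)%N -> w ** NI n = w ->
  (forall i, (1 <= i < j)%N -> w ** ND i n = 0) ->
  mulDlongest n j (mulXdelta n j w) = w.
Proof.
elim: j w => [//|j IH] w jn wn w0.
rewrite mulXdeltaS /mulDlongest; last lia.
rewrite w0wordS foldl_cat -/(mulDlongest n j _) IH ?mulX_mulD //; try lia.
  by apply: mulX_NI => //; lia.
by move=> i hi; apply: mulX_killed => //; [lia | apply: w0; lia].
Qed.

Lemma killed_ek n w : w ** NI n = w ->
  (forall i, (1 <= i < n)%N -> w ** ND i n = 0) -> w ** ek n = w.
Proof. by move=> wn w0; rewrite mul_ek // mulXdelta_mulD. Qed.

(** The inductive step of ∂_(k+1) ∂_j = 0: the word of ∂_(k+1) is that of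
    ∂_(k) followed by k, ..., 1. *)
Lemma mulDrun_killed n k z j : (k < n)%N ->
  (forall i, (1 <= i < k)%N -> z ** ND i n = 0) -> (1 <= j <= k)%N ->
  foldl (fun z i => z ** ND i n) z (rev (iota 1 k)) ** ND j n = 0.
Proof.
have e m : rev (iota 1 m.+1) = m.+1 :: rev (iota 1 m).
  by rewrite iota1_rcons rev_rcons.
elim: k z j => [|k IH] z j kn z0 hj; first lia.
rewrite e /=; have [jk|jk] := leqP j k.
  apply: IH; try lia; move=> i hi; rewrite mulDD ?z0 ?NHt_mul0l //; lia.
have {jk hj}-> : j = k.+1 by lia.
case: k {IH} kn z0 => [|k] kn z0; first by rewrite /= mulDD0 //; lia.
rewrite e /=.
(* ∂_{k+2} commutes with ∂_k ... ∂_1 *)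
have comm s y : {in s, forall i, (1 <= i <= k)%N} ->
    foldl (fun z i => z ** ND i n) y s ** ND k.+2 n =
    foldl (fun z i => z ** ND i n) (y ** ND k.+2 n) s.
  elim: s y => //= i s IH y hs; rewrite IH => [|l ls].
    by have := hs i (mem_head _ _) => hi; rewrite (mulDD y) //; lia.
  by apply: hs; rewrite inE ls orbT.
rewrite comm => [|i]; last by rewrite mem_rev mem_iota; lia.
rewrite mulDDD //.
rewrite (z0 k.+1) ?NHt_mul0l; last lia.
by elim: (rev _) => //= i s; rewrite NHt_mul0l.
Qed.

Lemma mulDlongest_killed n k z j : (k <= n)%N -> (1 <= j < k)%N ->
  mulDlongest n k z ** ND j n = 0.
Proof.
elim: k j => [|k IH] j kn hj; first lia.
rewrite /mulDlongest w0wordS foldl_cat; apply: mulDrun_killed; try lia.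
by move=> i hi; apply: IH; lia.
Qed.

Lemma NI_ek n : NI n ** ek n = ek n.
Proof. by have [t ->] := ek_mn n; rewrite !NHt_mulA NI_idem. Qed.

Lemma ek_ND n j : (1 <= j < n)%N -> ek n ** ND j n = 0.
Proof.
by move=> hj; rewrite -NI_ek mul_ek ?NI_idem // mulDlongest_killed.
Qed.

(** * The elements u_k *)

Lemma NHt_mulzl u v (m : int) : (u *~ m) ** v = (u ** v) *~ m.
Proof.
have N p : (u *+ p) ** v = (u ** v) *+ p.
  by elim: p => [|p IH]; rewrite ?NHt_mul0l // !mulrS NHt_mulDl IH.
by case: m => p; rewrite ?NegzE ?mulrNz -!pmulrn ?NHt_mulNl N.
Qed.

Lemma NHt_mulzr u v (m : int) : u ** (v *~ m) = (u ** v) *~ m.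
Proof.
have N p : u ** (v *+ p) = (u ** v) *+ p.
  by elim: p => [|p IH]; rewrite ?NHt_mul0r // !mulrS NHt_mulDr IH.
by case: m => p; rewrite ?NegzE ?mulrNz -!pmulrn ?NHt_mulNr N.
Qed.

Lemma euk_killed k j : (1 <= j <= k)%N ->
  ek k ** uk k.+1 ** ND j k.+1 = 0.
Proof.
move=> hj; rewrite -NHt_mulA /uk NHt_mul_suml NHt_mul_sumr.
under eq_bigr do rewrite NHt_mulzl NHt_mulzr.
(* split off the terms of index j and j + 1 *)
rewrite (@big_cat_nat _ _ _ j) //=; [|lia|lia].
rewrite (@big_ltn _ _ _ j) ?(@big_ltn _ _ _ j.+1); [|lia|lia].
have -> : NV j k.+1 ** ND j k.+1 = NV j.+1 k.+1 ** ND j k.+1.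
  by rewrite !cls_mul; apply: cls_rel; apply: rVD_eq; lia.
rewrite big_nat big1 => [|i hi]; last first.
  have -> : NV i k.+1 ** ND j k.+1 = ND j.-1 k ** NV i k.+1.
    by rewrite !cls_mul; apply: cls_rel; apply: rVD_lt; lia.
  by rewrite NHt_mulA ek_ND ?NHt_mul0l ?mul0rz //; lia.
rewrite big_nat big1 => [|i hi]; last first.
  have -> : NV i k.+1 ** ND j k.+1 = ND j k ** NV i k.+1.
    by rewrite !cls_mul; apply: cls_rel; apply: rVD_gt; lia.
  by rewrite NHt_mulA ek_ND ?NHt_mul0l ?mul0rz //; lia.
have -> : (j.+1.-1 = j.-1.+1)%N by lia.
by rewrite add0r addr0 exprS mulN1r mulrNz subrr.
Qed.

Lemma uk_uk k : uk k ** uk k.+1 = 0.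
Proof.
pose G i j := (NV i k ** NV j k.+1) *~ (-1) ^+ (i.-1 + j.-1).
have -> : uk k ** uk k.+1 = \sum_(1 <= i < k.+1) \sum_(1 <= j < k.+2) G i j.
  rewrite /uk NHt_mul_suml; apply: eq_bigr => i _.
  rewrite NHt_mul_sumr; apply: eq_bigr => j _.
  by rewrite NHt_mulzl NHt_mulzr -mulrzA -exprD addnC.
have GS i j : (1 <= i <= j)%N -> (j <= k)%N -> G i j.+1 = - G j i.
  move=> ij jk; rewrite /G.
  have -> : NV i k ** NV j.+1 k.+1 = NV j k ** NV i k.+1.
    by rewrite !cls_mul; apply: esym; apply: cls_rel; apply: rVV; lia.
  have -> : (i.-1 + j.+1.-1 = (j.-1 + i.-1).+1)%N by lia.
  by rewrite exprS mulN1r mulrNz.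
have split_row i : (1 <= i < k.+1)%N -> \sum_(1 <= j < k.+2) G i j =
    \sum_(1 <= j < k.+1 | (j <= i)%N) G i j - \sum_(1 <= j < k.+1 | (i <= j)%N) G j i.
  (* the terms with j > i are those of the pairs (i, j + 1) with j >= i *)
  move=> hi; rewrite (@big_cat_nat _ _ _ i.+1) //=; last lia.
  rewrite [X in _ + X]big_add1 (big_nat_widen _ _ k.+1) /=; last lia.
  rewrite (big_nat_widenl i 1) /=; last lia.
  congr (_ + _); rewrite -sumrN big_nat_cond [RHS]big_nat_cond.
  by apply: eq_bigr => j hj; apply: GS; lia.
rewrite (eq_big_nat _ _ split_row) sumrB [X in _ - X](exchange_big_dep_nat xpredT) //=.
by rewrite subrr.
Qed.

Lemma euek_eq0 k :
  ek k ** uk k.+1 ** ek k.+1 ** uk k.+2 ** ek k.+2 = 0.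
Proof.
rewrite (@killed_ek k.+1 (ek k ** uk k.+1)).
- by rewrite -(NHt_mulA (ek k)) uk_uk NHt_mul0r NHt_mul0l.
- by rewrite -NHt_mulA (NHmn_row (uk_mn k.+1)).
- by move=> j hj; apply: euk_killed.
Qed.

(** * Composition of right multiplications *)

(** On homogeneous elements, multiplying by c and then by c' on the last
    strands is multiplying by c c'. *)
Lemma rmul_fun_whisk k l c c' n u : (k <= n)%N -> NHmn k l c ->
  rmul_fun l c' (u ** NI n ** whisk (n - k) 0 c) =
  u ** NI n ** whisk (n - k) 0 (c ** c').
Proof.
move=> kn hc; have e : whisk (n - k) 0 c = whisk (n - k) 0 c ** NI (n - k + l).
  by rewrite -[X in NI X]addn0 -whiskI -whiskM (NHmn_row hc).
rewrite {1}e NHt_mulA rmul_fun_homog ?leq_addl // addnK -(NHt_mulA _ _ (NI _)) -e.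
by rewrite whiskM !NHt_mulA.
Qed.

Lemma NHmnM k l m c c' : NHmn k l c -> NHmn l m c' -> NHmn k m (c ** c').
Proof.
move=> [t ->] [t' ->]; apply: NHmn_lr; first by rewrite !NHt_mulA NI_idem.
by rewrite -!NHt_mulA NI_idem.
Qed.

Lemma du_du k (t : Fdiv k) : du k.+2 (du k.+1 t) = 0.
Proof.
apply: val_inj; apply: val_inj => /=.
have [x xt] := zs_valP (t : zs_type (bimg_sub (rek k))).
rewrite /F_val xt /= /F_val.
elim/Fpred_ind: (zs_valP (x : zs_type (F_sub k))) => [|y z hy hz|n u kn].
- by rewrite !rmul_fun0.
- by rewrite !rmul_funD hy hz addr0.
rewrite rmul_fun_homog //.
have h0 := ek_mn k; have h1 := NHmnM _ _ _ _ _ h0 (uk_mn k.+1).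
have h2 := NHmnM _ _ _ _ _ h1 (ek_mn k.+1); have h3 := NHmnM _ _ _ _ _ h2 (uk_mn k.+2).
rewrite (rmul_fun_whisk _ _ _ _ _ _ kn h0) (rmul_fun_whisk _ _ _ _ _ _ kn h1).
rewrite (rmul_fun_whisk _ _ _ _ _ _ kn h2) (rmul_fun_whisk _ _ _ _ _ _ kn h3).
by rewrite euek_eq0 whisk0 NHt_mul0r.
Qed.

Theorem mainTheorem1 :
  (forall k : nat, (1 <= k)%N ->
     forall t : Fdiv k.-1, bcomp (du k.+1) (du k) t = 0) /\
  is_cochain_complex expF.
Proof.
split=> [[//|k] _ t|[k|n] x]; [exact: du_du | exact: du_du | exact: bfun0].
Qed.
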